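(* For every integer $k\geq 1$, the formula with reversal $\phi_{3k}$ is $5$-avoidable. Moreover, the number of words of length $N$ over a $5$-letter alphabet that avoid $\phi_{3k}$ grows exponentially in $N$.
   Context: Let $\Sigma$ be a set of variables and $\Sigma^R=\{x^R:x\in\Sigma\}$. For words, $(a_1\cdots a_n)^R=a_n\cdots a_1$. A morphism $h$ on $(\Sigma\cup\Sigma^R)^*$ respects reversal if $h(x^R)=h(x)^R$. For $n\geq1$, $\phi_n$ is the formula with reversal whose fragments are $xy_1y_2\cdots y_nx$, $y_1^R,\dots,y_n^R$. A formula occurs in a word $u$ if there is a non-erasing morphism $h$ respecting reversal such that the image of every fragment is a factor of $u$; otherwise $u$ avoids it. A formula is $k$-avoidable if infinitely many words over a $k$-letter alphabet avoid it. *)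

(* Defs.v *)
From mathcomp Require Import all_boot all_order all_algebra.
From mathcomp Require Import boolp classical_sets cardinality reals.

Set Implicit Arguments.
Unset Strict Implicit.
Unset Printing Implicit Defensive.

Import Order.TTheory GRing.Theory Num.Theory.

(* V + V is the disjoint union of Sigma and Sigma^R: inl x is the variable x,
   inr x is the reversed variable x^R. *)
Definition formula (V : eqType) := seq (seq (V + V)%type).

Definition morphism_words (B A : Type) (h : seq B -> seq A) : Prop :=
  forall u v : seq B, h (u ++ v) = h u ++ h v.

Definition respects_reversal (V A : Type) (h : seq (V + V)%type -> seq A) :
    Prop :=
  forall x : V, h [:: inr x] = rev (h [:: inl x]).

Definition non_erasing (B A : Type) (h : seq B -> seq A) : Prop :=
  forall b : B, h [:: b] <> [::].

Definition occurs (V A : eqType) (phi : formula V) (u : seq A) : Prop :=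
  exists h : seq (V + V)%type -> seq A,
    [/\ morphism_words h, non_erasing h, respects_reversal h
      & forall f, f \in phi -> infix (h f) u].

Definition avoids (V A : eqType) (phi : formula V) (u : seq A) : Prop :=
  ~ occurs phi u.

Definition avoidable (k : nat) (V : eqType) (phi : formula V) : Prop :=
  infinite_set [set u : seq 'I_k | avoids phi u]%classic.

Definition num_avoiding (k : nat) (V : eqType) (phi : formula V) (N : nat) : nat :=
  #|[set w : N.-tuple 'I_k | `[< avoids phi (val w) >] ]|.

(* Over the variables nat: 0 stands for x and i stands for y_i, 1 <= i <= n. *)
Definition phi_ (n : nat) : formula nat :=
  (inl 0 :: [seq inl i | i <- iota 1 n] ++ [:: inl 0])
    :: [seq [:: inr i] | i <- iota 1 n].

(* Eventually bounded below and above by exponentials of base > 1. *)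
Definition grows_exponentially (R : realType) (f : nat -> nat) : Prop :=
  exists n0 : nat, exists c1 b1 c2 b2 : R,
    [/\ (0 < c1)%R, (1 < b1)%R, (0 < c2)%R, (1 < b2)%R
      & forall n : nat, n0 <= n ->
          (c1 * b1 ^+ n <= (f n)%:R)%R /\ ((f n)%:R <= c2 * b2 ^+ n)%R].

(* Main.v *)
Require Import Defs.
From mathcomp Require Import all_boot all_order all_algebra.
From mathcomp Require Import boolp classical_sets cardinality reals.
From mathcomp Require Import zify lra.

(** Write [d = k + 1] and let [v] be a square-free ternary word.  Repeat every
    letter of [v] [d] times and insert [34] before every letter of the result.
    In the word obtained the residue mod 3 of a position can be read off the
    letter, so the only factors whose reversal also occurs are single letters;
    an occurrence of [phi_ (3 * k)] is thus a factor [x y x] with [|y| = 3k],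
    and [3] divides [|x|].  This gives a repetition of period [p = j + k] and
    length [j] in the [d]-fold repetition of [v].  If [p = q d + r] with
    [r < d], the compared positions meet [q] consecutive blocks of [d] at points
    that are compared at distance exactly [q] blocks, whence a square in [v].

    There are exponentially many choices for [v]: replace each letter of a
    square-free word by one of two images of length 18 (a Brinkhuis triple).
    Factors of length 18 determine their position mod 18, so a square in the
    image either has period less than 18, which a finite check excludes, or
    period a multiple of 18; since the images of [a] end with [a], the latter
    projects to a square upstairs. *)

Set Implicit Arguments.
Unset Strict Implicit.
Unset Printing Implicit Defensive.

Import Order.TTheory GRing.Theory Num.Theory.

(** * Square-free ternary words from a Brinkhuis triple *)

Definition sqfree_on (n : nat) (f : nat -> nat) : Prop :=
  forall i p, 0 < p -> i + 2 * p <= n ->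
    ~ (forall j, j < p -> f (i + j) = f (i + j + p)).

(** The two images of 0, reversals of each other; [blk] shifts them mod 3 to get the images of 1 and
    2. *)
Definition base (e : bool) : seq nat :=
  if e then [:: 0; 1; 2; 0; 2; 1; 0; 2; 0; 1; 0; 2; 1; 2; 0; 2; 1; 0]
  else [:: 0; 1; 2; 0; 2; 1; 2; 0; 1; 0; 2; 0; 1; 2; 0; 2; 1; 0].

Definition blk (x : nat * bool) : seq nat :=
  [seq (c + x.1) %% 3 | c <- base x.2].

Definition subst (f : nat -> nat) (b : nat -> bool) (i : nat) : nat :=
  nth 0 (blk (f (i %/ 18), b (i %/ 18))) (i %% 18).

Definition syms : seq (nat * bool) :=
  [seq (a, e) | a <- iota 0 3, e <- [:: true; false]].

Definition window (o : nat) (x y : nat * bool) : seq nat :=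
  take 18 (drop o (blk x ++ blk y)).

Definition windows (o : nat) : seq (seq nat) :=
  undup [seq window o x y | x <- syms, y <- [seq y <- syms | x.1 != y.1]].

(** A square of period at most 17 starting in the first of three blocks ends by position 51 of 54,
    so [take] truncates nothing on three blocks. *)
Definition no_short_square (w : seq nat) : bool :=
  all (fun p => all (fun i => take p (drop i w) != take p (drop (i + p) w))
                  (iota 0 18)) (iota 1 17).

Lemma windows_synchronize :
  all (fun o => all (fun o' => (o == o') ||
         ~~ has (fun w => w \in windows o') (windows o)) (iota 0 18))
    (iota 0 18).
Proof. by vm_compute. Qed.

Lemma triples_no_short_square :
  all (fun x => all (fun y => (x.1 == y.1) || all (fun z => (y.1 == z.1) ||
    no_short_square (blk x ++ blk y ++ blk z)) syms) syms) syms.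
Proof. by vm_compute. Qed.

Lemma size_blk x : size (blk x) = 18.
Proof. by case: x => a []. Qed.

Lemma mem_syms a e : a < 3 -> (a, e) \in syms.
Proof. by case: a => [|[|[|//]]] _; case: e. Qed.

Lemma nth_last_blk a e : a < 3 -> nth 0 (blk (a, e)) 17 = a.
Proof. by case: a => [|[|[|//]]] _; case: e. Qed.

(** The two images of a letter first differ at position 6; the choice bits can be recovered
    there. *)
Lemma blk_bit a e e' : a < 3 -> nth 0 (blk (a, e)) 6 = nth 0 (blk (a, e')) 6 ->
  e = e'.
Proof. by case: a => [|[|[|//]]] _; case: e; case: e'. Qed.

Lemma take_drop_mkseq (U : nat -> nat) c w i p :
    (forall t, t < size w -> nth 0 w t = U (c + t)) -> i + p <= size w ->
  take p (drop i w) = mkseq (fun j => U (c + i + j)) p.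
Proof.
move=> Uw ip; apply: (@eq_from_nth _ 0).
  by rewrite size_mkseq size_take_min size_drop; lia.
move=> j; rewrite size_take_min size_drop => jlt.
by rewrite nth_take ?nth_mkseq ?nth_drop ?Uw ?addnA //; lia.
Qed.

Section Substitution.

Variables (f : nat -> nat) (b : nat -> bool).
Hypothesis f_lt3 : forall i, f i < 3.
Hypothesis f_adj : forall i, f i != f i.+1.

Let U := subst f b.

Definition fblk q := blk (f q, b q).

Lemma nth_fblk q t : t < 18 -> nth 0 (fblk q) t = U (q * 18 + t).
Proof.
move=> t18; rewrite /U /subst /fblk.
have -> : (q * 18 + t) %/ 18 = q by lia.
by have -> : (q * 18 + t) %% 18 = t by lia.
Qed.

Lemma nth_fblk2 q t : t < 36 ->
  nth 0 (fblk q ++ fblk q.+1) t = U (q * 18 + t).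
Proof.
move=> tlt; rewrite nth_cat size_blk; case: ltnP => t18; first exact: nth_fblk.
by rewrite nth_fblk; [congr U|]; lia.
Qed.

Lemma nth_fblk3 q t : t < 54 ->
  nth 0 (fblk q ++ fblk q.+1 ++ fblk q.+2) t = U (q * 18 + t).
Proof.
move=> tlt; rewrite nth_cat size_blk; case: ltnP => t18; first exact: nth_fblk.
by rewrite nth_fblk2; [congr U|]; lia.
Qed.

Lemma subst_lt3 i : U i < 3.
Proof.
rewrite /U /subst /blk (nth_map 0); first by rewrite ltn_mod.
by rewrite -(size_map (fun c => (c + f (i %/ 18)) %% 3))
  -/(blk (_, b (i %/ 18))) size_blk ltn_mod.
Qed.

(** Three consecutive blocks contain the square. Only [f_adj] is needed of [f], so this holds at
    every position, even past a square-free prefix. *)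
Lemma subst_no_short_square i p : 0 < p < 18 ->
  ~ (forall j, j < p -> U (i + j) = U (i + j + p)).
Proof.
move=> /andP[p0 p18] sq; pose q := i %/ 18; pose o := i %% 18.
have iE : i = q * 18 + o by rewrite /q /o; lia.
have o18 : o < 18 by rewrite ltn_mod.
have /allP/(_ _ (mem_syms (b q) (f_lt3 q)))/allP := triples_no_short_square.
move=> /(_ _ (mem_syms (b q.+1) (f_lt3 q.+1))).
case/orP => [fq|]; first by case/negP: (f_adj q).
move=> /allP/(_ _ (mem_syms (b q.+2) (f_lt3 q.+2))).
case/orP => [fq|]; first by case/negP: (f_adj q.+1).
have pin : p \in iota 1 17 by rewrite mem_iota; lia.
have oin : o \in iota 0 18 by rewrite mem_iota; lia.
move=> /allP/(_ _ pin)/allP/(_ _ oin)/eqP; apply.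
have sz : size (fblk q ++ fblk q.+1 ++ fblk q.+2) = 54.
  by rewrite !size_cat !size_blk.
have nthU t : t < size (fblk q ++ fblk q.+1 ++ fblk q.+2) ->
    nth 0 (fblk q ++ fblk q.+1 ++ fblk q.+2) t = U (q * 18 + t).
  by rewrite sz; apply: nth_fblk3.
rewrite (take_drop_mkseq nthU) ?(take_drop_mkseq nthU) ?sz; try lia.
apply: (@eq_from_nth _ 0); rewrite ?size_mkseq // => j jp.
rewrite !nth_mkseq //.
have -> : q * 18 + (o + p) + j = i + j + p by lia.
by rewrite -iE; apply: sq.
Qed.

Lemma subst_adj i : U i != U i.+1.
Proof.
apply/eqP => Ui; apply: (@subst_no_short_square i 1) => // j.
by rewrite ltnS leqn0 => /eqP ->; rewrite addn0 addn1.
Qed.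

Lemma window_mem i : mkseq (fun j => U (i + j)) 18 \in windows (i %% 18).
Proof.
pose q := i %/ 18.
have iE : i = q * 18 + i %% 18 by rewrite /q; lia.
have i18 : i %% 18 < 18 by rewrite ltn_mod.
rewrite mem_undup; apply/allpairsPdep.
exists (f q, b q), (f q.+1, b q.+1); split.
- exact: mem_syms.
- by rewrite mem_filter /= f_adj mem_syms.
- rewrite /window (@take_drop_mkseq U (q * 18)) -?iE //.
    by move=> t; rewrite size_cat !size_blk; apply: nth_fblk2.
  by rewrite size_cat !size_blk; lia.
Qed.

Lemma subst_block_end q : U (q * 18 + 17) = f q.
Proof. by rewrite -nth_fblk // nth_last_blk. Qed.

Lemma subst_sqfree n : sqfree_on n f -> sqfree_on (n * 18) U.
Proof.
move=> fsq i p p0 ipn sq.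
have [p18|p18] := ltnP p 18.
  by apply: (@subst_no_short_square i p) => //; rewrite p0.
(* As [p >= 18], the windows of length 18 at [i] and [i + p] coincide. *)
have sync : i %% 18 = (i + p) %% 18.
  have oin j : j %% 18 \in iota 0 18 by rewrite mem_iota ltn_mod.
  have /allP/(_ _ (oin i))/allP/(_ _ (oin (i + p))) := windows_synchronize.
  case/orP => [/eqP//|/hasPn/(_ _ (window_mem i))/negP[]].
  suff -> : mkseq (fun j => U (i + j)) 18 = mkseq (fun j => U (i + p + j)) 18.
    exact: window_mem.
  apply: (@eq_from_nth _ 0); rewrite ?size_mkseq // => j jp.
  by rewrite !nth_mkseq // sq 1?addnAC //; lia.
pose q := p %/ 18; have pE : p = q * 18 by rewrite /q; lia.
apply: (fsq (i %/ 18) q); [lia|lia|move=> s sq_lt].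
(* The last position of block [i %/ 18 + s] lies in the first half of the square because [s < q]. *)
rewrite -!subst_block_end.
have := sq ((i %/ 18 + s) * 18 + 17 - i).
have -> : i + ((i %/ 18 + s) * 18 + 17 - i) = (i %/ 18 + s) * 18 + 17 by lia.
have -> : (i %/ 18 + s) * 18 + 17 + p = (i %/ 18 + s + q) * 18 + 17 by lia.
by apply; lia.
Qed.

End Substitution.

(** Iterating the substitution multiplies the square-free length by 18, starting from 0101... and
    length 1. Neighbours differ at all positions, which keeps the induction going. *)
Lemma ternary_sqfree_exists n : exists f : nat -> nat,
  [/\ forall i, f i < 3, forall i, f i != f i.+1 & sqfree_on n f].
Proof.
suff [f [f3 fadj fsq]] : exists f : nat -> nat,
    [/\ forall i, f i < 3, forall i, f i != f i.+1 & sqfree_on (18 ^ n) f].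
  exists f; split=> // i p p0 ipn; apply: fsq => //.
  by apply: leq_trans ipn _; apply/ltnW/ltn_expl.
elim: n => [|n [f [f3 fadj fsq]]].
  exists (fun i => i %% 2); split=> [i|i|i p]; [lia|lia|].
  by rewrite expn0; lia.
exists (subst f (fun=> true)); split.
- by move=> i; apply: subst_lt3.
- by move=> i; apply: subst_adj.
- by rewrite expnS mulnC; apply: subst_sqfree.
Qed.

(** * Gapped repeats in a word with repeated letters *)

Lemma gapped_repeat_square (v : nat -> nat) (d i j M : nat) :
    0 < d -> 0 < j ->
    (forall t, t < j -> v ((i + t) %/ d) = v ((i + t + (j + d.-1)) %/ d)) ->
    (forall t, t < j -> (i + t + (j + d.-1)) %/ d < M) ->
  ~ sqfree_on M v.
Proof.
move=> d0 j0 rep bnd vsq; pose p := j + d.-1.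
pose q := p %/ d; pose r := p %% d; pose o := i %% d; pose a0 := i %/ d.
have pE : p = q * d + r by rewrite /q /r -divn_eq.
have iE : i = a0 * d + o by rewrite /a0 /o -divn_eq.
have r_lt : r < d by rewrite ltn_mod.
have o_lt : o < d by rewrite ltn_mod.
have q0 : 0 < q by rewrite divn_gt0 // /p; lia.
have jE : j = q.-1 * d + r + 1.
  have : q * d = q.-1 * d + d by rewrite -{1}(prednK q0) mulSn addnC.
  by rewrite /p in pE; lia.
have div_eq c s : s < d -> (c * d + s) %/ d = c.
  by move=> sd; rewrite divnMDl // divn_small // addn0.
suff [a ha] : exists a, forall s, s < q ->
    v (a + s) = v (a + s + q) /\ a + s + q < M.
  apply: (vsq a q q0) => [|s /ha[]//].
  by have [|_] := ha q.-1; lia.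
(* Adding [p = q * d + r] to offset [s] of block [c] stays within block [c + q] when no carry
   occurs. *)
have sample c s : s + r < d -> i <= c * d + s -> c * d + s < i + j ->
    v c = v (c + q) /\ c + q < M.
  move=> sr le1 lt1.
  have tj : c * d + s - i < j by lia.
  have := rep _ tj; have := bnd _ tj.
  have -> : i + (c * d + s - i) = c * d + s by lia.
  have -> : c * d + s + (j + d.-1) = (c + q) * d + (s + r).
    by rewrite -/p pE mulnDl; lia.
  by rewrite !div_eq //; lia.
have mul_le s : s < q -> s * d <= q.-1 * d by move=> ?; rewrite leq_mul2r; lia.
(* Without a carry at [i] itself, sample there and then at the starts of the next [q.-1] blocks.
   Otherwise [o + r >= d] makes the repeat long enough to reach the starts of [q] blocks after
   [a0]. *)
have [or_lt|or_ge] := ltnP (o + r) d.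
  exists a0 => -[|s] sq_lt.
    by rewrite addn0; apply: (sample a0 o) => //; lia.
  have := mul_le _ sq_lt.
  by move=> ?; apply: (sample (a0 + s.+1) 0); rewrite ?mulnDl ?mulSn; lia.
exists a0.+1 => s sq_lt; have := mul_le _ sq_lt => ?.
by apply: (sample (a0.+1 + s) 0); rewrite ?mulnDl ?mulSn; lia.
Qed.

(** * The encoding over five letters *)

Lemma morphism_flatten (B A : Type) (h : seq B -> seq A) s :
  morphism_words h -> h s = flatten [seq h [:: c] | c <- s].
Proof.
move=> hM; elim: s => [|c s IH] /=; last by rewrite -IH -hM.
apply: size0nil; have := congr1 size (hM [::] [::]).
by rewrite /= size_cat; lia.
Qed.

Lemma size_flatten1 (T : Type) (I : eqType) (F : I -> seq T) s :
  {in s, forall i, size (F i) = 1} -> size (flatten (map F s)) = size s.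
Proof.
elim: s => //= i s IH F1; rewrite size_cat F1 ?mem_head // IH // => c cs.
by apply: F1; rewrite inE cs orbT.
Qed.

Section Encoding.

Variables (k : nat) (v : nat -> nat).
Hypothesis v_lt3 : forall i, v i < 3.

Definition enc_nat (i : nat) : nat :=
  if i %% 3 == 0 then 3 else if i %% 3 == 1 then 4 else v (i %/ (3 * k.+1)).

Definition enc (i : nat) : 'I_5 := inord (enc_nat i).

Lemma enc_val i : enc i = enc_nat i :> nat.
Proof.
rewrite inordK // /enc_nat; case: ifP => // _; case: ifP => // _.
exact: leq_trans (v_lt3 _) _.
Qed.

Definition residue (a : 'I_5) : nat :=
  if a == 3 :> nat then 0 else if a == 4 :> nat then 1 else 2.

Lemma residue_enc i : residue (enc i) = i %% 3.
Proof.
rewrite /residue enc_val /enc_nat.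
have := v_lt3 (i %/ (3 * k.+1)).
case: (i %% 3) (ltn_pmod i (isT : 0 < 3)) => [|[|[|//]]] _ //=.
by case: (v _) => [|[|[|]]].
Qed.

Lemma enc_letter s : enc (3 * s + 2) = v (s %/ k.+1) :> nat.
Proof.
rewrite enc_val /enc_nat.
have -> : (3 * s + 2) %% 3 = 2 by lia.
by rewrite /= divnMA; congr (v (_ %/ _)); lia.
Qed.

Definition enc_word N := mkseq enc N.

Lemma infix_enc_word y N : infix y (enc_word N) ->
  exists2 i, i + size y <= N
    & forall t, t < size y -> nth ord0 y t = enc (i + t).
Proof.
move=> /infixP[s1 [s2 E]].
have sz : N = size s1 + (size y + size s2).
  by rewrite -!size_cat -E size_mkseq.
exists (size s1) => [|t ty]; first by lia.
rewrite -(@nth_mkseq _ ord0 enc N) ?sz; last by lia.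
by rewrite -sz -/(enc_word N) E nth_cat ltnNge leq_addr addKn nth_cat ty.
Qed.

(** Two adjacent letters have residues [r] and [r + 1]; seen in reverse order they would force
    [r = r + 2] mod 3. *)
Lemma reversible_size y N : infix y (enc_word N) ->
  infix (rev y) (enc_word N) -> size y <= 1.
Proof.
case: y => [|a [|c y]] // /infix_enc_word[i _ yi] /infix_enc_word[i' _ yi'].
have Ea := yi 0 isT; have Ec := yi 1 isT.
rewrite /= in Ea Ec; rewrite size_rev /= in yi'.
have Ea' := yi' (size y).+1 (leqnn _).
have Ec' := yi' (size y) (leqnSn _).
rewrite nth_rev /= ?ltnS // subnn /= in Ea'.
rewrite nth_rev /= ?ltnS // subSS subSnn /= in Ec'.
move/(congr1 residue): Ea'; move/(congr1 residue): Ec'.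
by rewrite Ea Ec !residue_enc; lia.
Qed.

Lemma enc_word_no_gapped_repeat x y N M :
    sqfree_on M v -> N <= M * (3 * k.+1) -> x <> [::] -> size y = 3 * k ->
  ~ infix (x ++ y ++ x) (enc_word N).
Proof.
move=> vsq NM xn ysz /infix_enc_word[i]; rewrite !size_cat ysz => iN xyx.
set m := size x in iN xyx.
have m0 : 0 < m by rewrite lt0n size_eq0; apply/eqP.
have rep t : t < m -> enc (i + t) = enc (i + t + (m + 3 * k)).
  move=> tm; rewrite -xyx; last by lia.
  have -> : i + t + (m + 3 * k) = i + (m + 3 * k + t) by lia.
  rewrite -xyx; last by lia.
  rewrite !nth_cat -/m tm !ifF ?ysz; try lia.
  by congr nth; lia.
have m3 : m %% 3 = 0.
  by have := congr1 residue (rep 0 m0); rewrite !residue_enc; lia.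
pose j := m %/ 3; have mE : m = 3 * j by rewrite /j; lia.
(* Keep only positions 2 mod 3, which carry the letters of [v]: the period [m + 3 * k] becomes
   [j + k], that is [j + d.-1] for [d = k.+1]. *)
apply: (@gapped_repeat_square v k.+1 (i %/ 3) j M) => //; first by lia.
- move=> t tj /=.
  have := rep (3 * (i %/ 3 + t) + 2 - i).
  have -> : i + (3 * (i %/ 3 + t) + 2 - i) = 3 * (i %/ 3 + t) + 2 by lia.
  have -> : 3 * (i %/ 3 + t) + 2 + (m + 3 * k) =
            3 * (i %/ 3 + t + (j + k)) + 2 by lia.
  by move=> E; rewrite -!enc_letter E //; lia.
- by move=> t tj /=; rewrite ltn_divLR //; lia.
Qed.

Lemma enc_word_avoids N M : sqfree_on M v -> N <= M * (3 * k.+1) ->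
  avoids (phi_ (3 * k)) (enc_word N).
Proof.
move=> vsq NM [h [hM hne hrev hin]].
pose ys : seq (nat + nat) := [seq inl i | i <- iota 1 (3 * k)].
have frag : infix (h [:: inl 0] ++ h ys ++ h [:: inl 0]) (enc_word N).
  by rewrite -!hM; apply: hin; rewrite mem_head.
apply: (enc_word_no_gapped_repeat vsq NM (hne (inl 0)) _ frag).
rewrite (morphism_flatten ys hM) -map_comp size_flatten1 ?size_iota //.
move=> i iin /=.
have y0 : 0 < size (h [:: inl i]).
  by rewrite lt0n size_eq0; apply/eqP; apply: hne.
apply/eqP; rewrite eqn_leq y0 andbT.
apply: (@reversible_size _ N); last first.
  by rewrite -hrev; apply: hin; rewrite inE map_f ?orbT.
apply: infix_trans frag.
apply: infix_trans (infix_catl _ (infix_catr _ (infix_refl _))).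
have [s1 [s2 ysE]] : exists s1 s2, ys = s1 ++ [:: inl i] ++ s2.
  have := map_f (@inl nat nat) iin; rewrite -/ys => /splitPr[s1 s2].
  by exists s1, s2.
by rewrite ysE !hM; apply: infix_infix.
Qed.

End Encoding.

(** * Counting avoiding words *)

Lemma num_avoiding_ge k N :
  2 ^ (N %/ (54 * k.+1)) <= num_avoiding 5 (phi_ (3 * k)) N.
Proof.
(* One letter of [f], hence one free bit, yields [18 * 3 * k.+1] letters. [T] such blocks fit in
   length [N], and [T.+1] cover it; the last one uses the default bit [false]. *)
set T := N %/ (54 * k.+1).
have NT1 : N <= (T.+1 * 18) * (3 * k.+1).
  have := ltn_ceil N (isT : 0 < 54 * k.+1); rewrite -/T; lia.
have NT0 : (T * 18) * (3 * k.+1) <= N.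
  have := leq_divM N (54 * k.+1); rewrite -/T; lia.
have [f [f3 fadj fsq]] := ternary_sqfree_exists T.+1.
pose v (t : T.-tuple bool) := subst f (nth false t).
have v3 t i : v t i < 3 by apply: subst_lt3.
pose w (t : T.-tuple bool) : N.-tuple 'I_5 := [tuple enc k (v t) i | i < N].
have w_val t : val (w t) = enc_word k (v t) N.
  apply: (@eq_from_nth _ ord0) => [|i]; rewrite size_tuple ?size_mkseq // => iN.
  by rewrite nth_mkseq // -(tnth_nth _ _ (Ordinal iN)) tnth_mktuple.
have w_inj : injective w.
  move=> t t' /(congr1 val); rewrite !w_val => E.
  apply/val_inj/(@eq_from_nth _ false) => [|s]; rewrite !size_tuple // => sT.
  apply: (@blk_bit (f s)) => //.
  (* The first copy of letter 6 of block [s], which sits at position [3 * c + 2] of the encoding. *)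
  pose c := (s * 18 + 6) * k.+1.
  have cN : 3 * c + 2 < N.
    apply: leq_trans NT0; have : s.+1 * (18 * k.+1) <= T * (18 * k.+1).
      by rewrite leq_mul2r sT orbT.
    by rewrite /c; lia.
  have := congr1 (fun u => val (nth ord0 u (3 * c + 2))) E.
  rewrite /= !nth_mkseq // !enc_letter // /c mulnK // /v /subst.
  have -> : (s * 18 + 6) %/ 18 = s by lia.
  by have -> : (s * 18 + 6) %% 18 = 6 by lia.
have -> : 2 ^ T = #|w @: [set: T.-tuple bool]|.
  by rewrite card_imset // cardsT card_tuple card_bool.
apply: subset_leq_card; apply/fintype.subsetP => _ /imsetP[t _ ->].
rewrite inE; apply/asboolP; rewrite w_val.
by apply: (@enc_word_avoids _ _ _ _ (T.+1 * 18)) => //; apply: subst_sqfree.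
Qed.

Lemma num_avoiding_le k N (V : eqType) (phi : formula V) :
  num_avoiding k phi N <= k ^ N.
Proof.
by apply: leq_trans (max_card _) _; rewrite card_tuple card_ord.
Qed.

(** * Exponential growth *)

Section Growth.

Local Open Scope ring_scope.

Lemma bernoulli (R : realFieldType) (x : R) n :
  0 <= x <= 1 -> 1 - x *+ n <= (1 - x) ^+ n.
Proof.
move=> /andP[x0 x1]; elim: n => [|n IH]; first by rewrite mulr0n subr0 expr0.
rewrite exprS.
apply: le_trans (ler_wpM2l _ IH); last by rewrite subr_ge0.
have : 0 <= x *+ n by rewrite mulrn_wge0.
by rewrite mulrS; nra.
Qed.

(* Bernoulli's inequality gives [(1 - 1/(2m)) ^+ m >= 1/2]. *)
Lemma root2_lower (R : realFieldType) m : (0 < m)%N ->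
  exists2 b : R, 1 < b & b ^+ m <= 2.
Proof.
move=> m0; pose x : R := (2 * m)%:R^-1.
have m2 : (0 < (2 * m)%:R :> R) by rewrite ltr0n muln_gt0.
have x0 : 0 < x by rewrite invr_gt0.
have x1 : x < 1 by rewrite invf_lt1 // ltr1n; lia.
have y0 : 0 < 1 - x by rewrite subr_gt0.
exists (1 - x)^-1; first by rewrite invf_gt1 // ltrBlDr ltrDl.
rewrite exprVn -[leRHS]invrK lef_pV2 ?posrE ?invr_gt0 ?exprn_gt0 //.
apply: le_trans (bernoulli m _); last by rewrite !ltW.
have -> : x *+ m = 2^-1.
  by rewrite -[x *+ m]mulr_natr /x natrM invfM -mulrA mulVf ?mulr1 // pnatr_eq0; lia.
by lra.
Qed.

End Growth.

(** Finitely many words have bounded length, yet avoiding words exist beyond any bound. *)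
Lemma avoidable_of_all_lengths k (V : eqType) (phi : formula V) n0 :
  (forall N, n0 <= N -> 0 < num_avoiding k phi N) -> avoidable k phi.
Proof.
move=> pos fin.
have /finite_seqP[s sE] := finite_image size fin.
pose N := n0 + (\max_(i <- s) i).+1.
have /card_gt0P[w] := pos N (leq_addr _ _); rewrite inE => /asboolP wav.
have : N \in s.
  suff : [set` s]%classic N by [].
  by rewrite -sE; exists (val w); rewrite ?size_tuple.
move=> Ns; have : N <= \max_(i <- s) i by apply: leq_bigmax_seq.
by rewrite /N; lia.
Qed.

Theorem theorem3p1 (R : realType) (k : nat) (hk : 1 <= k) :
  avoidable 5 (phi_ (3 * k)) /\
  grows_exponentially R (num_avoiding 5 (phi_ (3 * k))).
Proof.
split.
  apply: (@avoidable_of_all_lengths _ _ _ 0) => N _.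
  by apply: leq_trans (num_avoiding_ge k N); rewrite expn_gt0.
pose m := 54 * k.+1.
have [b b1 bm] := @root2_lower R m isT.
(* The factor 1/2 absorbs the rounding in [n %/ m]: [b ^+ n] is at most [2 ^+ (n %/ m).+1]. The
   upper bound counts all words. *)
exists 0, (2^-1)%R, b, 1%R, 5%:R%R.
split; rewrite ?invr_gt0 ?ltr0n ?ltr01 ?ltr1n // => n _; split; last first.
  by rewrite mul1r -natrX ler_nat num_avoiding_le.
apply: (@le_trans _ _ (2 ^+ (n %/ m))%R); last first.
  by rewrite -natrX ler_nat num_avoiding_ge.
rewrite mulrC ler_pdivrMr ?ltr0n // -exprSr.
apply: (@le_trans _ _ (b ^+ (m * (n %/ m).+1))%R).
  by apply: ler_weXn2l; [exact: ltW | rewrite mulnC ltnW // ltn_ceil].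
by rewrite exprM lerXn2r ?nnegrE ?exprn_ge0 // ltW // (lt_trans ltr01).
Qed.
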